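(* A metric space $(X,d)$ is isometric to the real line if and only if $X$ is a complete Banakh space such that $G_+\subseteq d[X^2]$ for some non-cyclic subgroup $G$ of the additive group $\mathbb{Q}$ of rational numbers.
   Context: For a metric space $(X,d)$, $d[X^2]=\{d(x,y):x,y\in X\}$ is its set of distances, and for $c\in X$, $r\in\mathbb{R}$, $\mathsf{S}(c;r)=\{x\in X:d(x,c)=r\}$. A metric space $(X,d)$ is a Banakh space if for every $c\in X$ and every $r\in d[X^2]$ there exist points $x,y\in X$ such that $\mathsf{S}(c;r)=\{x,y\}$ and $d(x,y)=2r$. For a set $G\subseteq\mathbb{R}$, $G_+=\{x\in G:x\ge 0\}$. An isometry is a surjective distance-preserving map; two metric spaces are isometric if there is an isometry between them. The real line carries the metric $|x-y|$. *)

(* Defs.v *)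
From mathcomp Require Import all_boot all_order all_algebra.
From mathcomp Require Import all_classical all_reals all_analysis.

Set Implicit Arguments.
Unset Strict Implicit.
Unset Printing Implicit Defensive.

Import Order.TTheory GRing.Theory Num.Theory.
Import numFieldNormedType.Exports.

Local Open Scope classical_set_scope.
Local Open Scope ring_scope.

Section MetricSpaces.
Context {R : realType}.

Definition distances (X : metricType R) : set R :=
  range (fun p : X * X => mdist p.1 p.2).

Definition sphere {X : metricType R} (c : X) (r : R) : set X :=
  [set x | mdist x c = r].

(* The points x and y are not required to be distinct: they coincide for
   r = 0. *)
Definition banakh_space (X : metricType R) : Prop :=
  forall (c : X) (r : R), distances X r ->
    exists x y : X, sphere c r = [set x; y] /\ mdist x y = 2 * r.

(* The axiom of [completeType], with the limit quantified existentially: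
   [completeType] extends [pointedType], whereas X may be empty here. *)
Definition complete_space (X : metricType R) : Prop :=
  forall F : set_system X, ProperFilter F -> cauchy F -> exists x : X, F --> x.

Definition isometry {X Y : metricType R} (f : X -> Y) : Prop :=
  (forall x y : X, mdist (f x) (f y) = mdist x y) /\ set_surj setT setT f.

Definition isometric (X Y : metricType R) : Prop :=
  exists f : X -> Y, isometry f.

Definition nonneg_part (G : set R) : set R := [set x | G x /\ 0 <= x].

End MetricSpaces.

Definition cyclic_subgroup {V : zmodType} (G : {pred V}) : Prop :=
  exists g : V, [set` G] = range (fun n : int => g *~ n).

(* Main.v *)
(* In a Banakh space the two points of a sphere are antipodal. Iterating the
   antipodal map shows that every distance [r > 0] is the step of an isometric
   copy of [r Z] through any point [c]. Fix [c] and [p] at distance [g > 0] in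
   [G]. As a point is determined by its distances to [c] and [p], the copies of
   [e Z] for [e] in [G] fit together into an isometric copy of [G], because
   finitely many elements of [G] are multiples of a common one. A non-cyclic
   [G] is dense, so completeness yields an isometric copy of the whole line,
   and it exhausts [X]: a sphere about a point of the line already meets the
   line in two points. *)
Require Import Defs.
From mathcomp Require Import all_boot all_order all_algebra.
From mathcomp Require Import all_classical all_reals all_analysis.
From mathcomp Require Import zify ring lra.

Import Order.TTheory GRing.Theory Num.Theory.
Import numFieldNormedType.Exports.

Local Open Scope classical_set_scope.
Local Open Scope ring_scope.

(** * Spheres, antipodes and equally spaced chains in a Banakh space *)

Section BanakhGeometry.
Context {R : realType} {X : metricType R}.
Hypothesis banakhX : banakh_space X.
Implicit Types (c p x y : X) (r : R).

Lemma sphere_nonempty {r} c : distances X r -> exists x, mdist x c = r.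
Proof.
move=> /(banakhX c)[x [y [Scr _]]]; exists x.
by have : sphere c r x by rewrite Scr; left.
Qed.

Lemma exists_antipode c x :
  exists y, mdist y c = mdist x c /\ mdist x y = 2 * mdist x c.
Proof.
have [|u [v [Sc duv]]] := banakhX c (mdist x c); first by exists (x, c).
have su : sphere c (mdist x c) u by rewrite Sc; left.
have sv : sphere c (mdist x c) v by rewrite Sc; right.
have : sphere c (mdist x c) x by [].
rewrite {1}Sc => -[/= xu|/= xv].
  by exists v; split=> //; rewrite -duv -xu.
by exists u; split=> //; rewrite -duv metric_sym -xv.
Qed.

Lemma cospherical_eq c x y z :
  mdist y c = mdist x c -> mdist z c = mdist x c -> x != y -> z = x \/ z = y.
Proof.
move=> yc zc /eqP xy.
have [|u [v [Sc _]]] := banakhX c (mdist x c); first by exists (x, c).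
have : sphere c (mdist x c) x by [].
have : sphere c (mdist x c) y by [].
have : sphere c (mdist x c) z by [].
rewrite Sc => -[]/= zE []/= yE []/= xE; first [by left; rewrite zE xE
  | by right; rewrite zE yE | by case: xy; rewrite xE yE].
Qed.

(** The antipode of [x] about [c] lies on the same sphere, so it is [x] or [y]; if it were [x], the
    radius would vanish and [y] would equal [x]. *)
Lemma dist_cospherical c x y :
  mdist y c = mdist x c -> x != y -> mdist x y = 2 * mdist x c.
Proof.
move=> yc xy; have [z [zc xz]] := exists_antipode c x.
have [zx|<-//] := cospherical_eq c x y z yc zc xy.
have := xz; rewrite zx mdistxx => /esym/eqP.
rewrite mulf_eq0 pnatr_eq0/= => /eqP xc; move: yc xy; rewrite xc.
by move=> /mdist_positivity ->; rewrite (mdist_positivity _ _ xc) eqxx.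
Qed.

(* If [x != y], then [c], [x], [p], [y] form a cycle of four points with sides
   [a] and diagonals [2 a]. The antipode [w] of [p] about [c] is then at
   distance [3 a] from both [x] and [y], which forces [mdist x y = 6 a]. *)
Lemma eq_from_two_distances c p x y : c != p ->
  mdist x c = mdist y c -> mdist x p = mdist y p -> x = y.
Proof.
move=> cp xyc xyp; have [//|xy] := eqVneq x y.
have xy1 := dist_cospherical _ _ _ (esym xyc) xy.
have xy2 := dist_cospherical _ _ _ (esym xyp) xy.
have cx : mdist p x = mdist c x by rewrite !(metric_sym _ x); lra.
have cp1 := dist_cospherical _ _ _ cx cp.
have [w [wc pw]] := exists_antipode c p.
have dist_w z : mdist z c = mdist x c -> mdist z p = mdist x c ->
    mdist z w = 3 * mdist x c.
  move=> zc zp; have := metric_triangle z c w; have := metric_triangle p z w.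
  have := metric_sym p z; have := metric_sym w c; have := metric_sym c p.
  have := metric_sym c x; lra.
have xw := dist_w x erefl ltac:(lra).
have yw := dist_w y (esym xyc) ltac:(lra).
have := dist_cospherical w x y ltac:(by rewrite xw yw) xy.
have : 0 < mdist x y by rewrite mdist_gt0.
by move=> xy0 xyw; exfalso; lra.
Qed.

Section Chain.
Context (r : R) (u : nat -> X).
Hypothesis r_gt0 : 0 < r.
Hypothesis step1 : forall n, mdist (u n) (u n.+1) = r.
Hypothesis step2 : forall n, mdist (u n) (u n.+2) = 2 * r.

(** Strong induction on [k]. Going as far beyond [u (n + k).+2] as [u n] lies before it gives a
    point [v] on the same sphere about that centre. If [v] differs from [u n], the two are opposite,
    and the triangle through [u (n + k).+3] and [v] gives the lower bound; the path through the
    centre gives the upper one. *)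
Lemma chain_distD n k : mdist (u n) (u (n + k)) = k%:R * r.
Proof.
elim/ltn_ind: k n => -[|[|[|k]]] IH n.
- by rewrite addn0 mdistxx mul0r.
- by rewrite addn1 step1 mul1r.
- by rewrite addn2 step2.
set v := u ((n + k).+2 + k.+2)%N.
have d0c : mdist (u n) (u (n + k).+2) = k.+2%:R * r by rewrite -!addnS IH.
have d1c : mdist (u (n + k).+2) v = k.+2%:R * r by rewrite IH.
have d01 : mdist (u n) (u (n + k).+1) = k.+1%:R * r by rewrite -addnS IH.
have d11 : mdist (u (n + k).+3) v = k.+1%:R * r by rewrite /v -addSnnS IH.
rewrite 3!addnS.
have k2 : k.+2%:R = k.+1%:R + 1 :> R by rewrite -natr1.
have k3 : k.+3%:R = k.+1%:R + 2 :> R by rewrite -addn2 natrD.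
have kr : 0 <= k.+1%:R * r by rewrite mulr_ge0// ltW.
(* If the chain closes up, both neighbours of the centre have the same distances to the centre and
   to [u n], hence coincide, against [step2]. *)
have [loop|noloop] := eqVneq (u n) v.
  have cu : u (n + k).+2 != u n.
    by rewrite -mdist_gt0 metric_sym d0c mulr_gt0.
  have e : u (n + k).+1 = u (n + k).+3.
    apply: (eq_from_two_distances _ _ _ _ cu).
      by rewrite [RHS]metric_sym !step1.
    by rewrite metric_sym d01 loop d11.
  by have := step2 (n + k).+1; rewrite -e mdistxx; lra.
have := dist_cospherical (u (n + k).+2) (u n) v.
rewrite metric_sym d1c d0c => /(_ erefl noloop) dnv.
have := metric_triangle (u n) (u (n + k).+3) v.
have := metric_triangle (u n) (u (n + k).+2) (u (n + k).+3).
rewrite step1; nra.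
Qed.

Lemma chain_dist i j : mdist (u i) (u j) = `|i%:R - j%:R| * r.
Proof.
wlog ij : i j / (i <= j)%N.
  by move=> H; case/orP: (leq_total i j) => /H //; rewrite metric_sym distrC.
rewrite -(subnKC ij) chain_distD natrD opprD addrA subrr add0r normrN.
by rewrite ger0_norm.
Qed.

End Chain.

Lemma exists_ray c p : exists u : nat -> X, [/\ u 0 = c, u 1 = p,
  forall n, mdist (u n) (u n.+1) = mdist c p &
  forall n, mdist (u n) (u n.+2) = 2 * mdist c p].
Proof.
pose P (z : X * X) y :=
  mdist y z.2 = mdist z.1 z.2 /\ mdist z.1 y = 2 * mdist z.1 z.2.
have [f fP] : {f & forall z, P z (f z)}.
  by apply: boolp.choice => -[x y]; exact: exists_antipode.
(* The state holds two consecutive points; [f] sends the first to its antipode about the second. *)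
pose st n := iter n (fun z => (z.2, f z)) (c, p).
have stP n : mdist (st n).1 (st n).2 = mdist c p.
  by elim: n => //= n <-; rewrite metric_sym (fP _).1.
exists (fun n => (st n).1); split=> // n.
by rewrite /= (fP _).2 stP.
Qed.

(** Two rays, through [p] and through its antipode [q], are glued at [c]. Cutting one off after [N]
    steps yields a chain indexed by [nat], to which [chain_dist] applies. *)
Lemma exists_line r c (N : nat) : 0 < r -> distances X r ->
  exists u : int -> X, u 0 = c /\
    forall i j : int, - N%:Z <= i -> - N%:Z <= j ->
      mdist (u i) (u j) = `|i%:~R - j%:~R| * r.
Proof.
move=> r0 /(sphere_nonempty c)[p pc].
have [q [qc pq]] := exists_antipode c p.
rewrite pc in qc pq; rewrite metric_sym in pc; rewrite metric_sym in qc.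
have [x [x0 x1 xS xSS]] := exists_ray c p.
have [y [y0 y1 yS ySS]] := exists_ray c q.
rewrite pc in xS xSS; rewrite qc in yS ySS.
pose z n := if (n <= N)%N then y (N - n)%N else x (n - N)%N.
have zx n : z (N + n)%N = x n.
  rewrite /z addKn; case: leqP => // Nn.
  have n0 : n = 0%N by lia.
  by rewrite n0 addn0 subnn x0 y0.
have zy n m : (n + m = N)%N -> z n = y m.
  by move=> nmN; rewrite /z -nmN leq_addr addKn.
have zS n : mdist (z n) (z n.+1) = r.
  have [Nn|nN] := leqP N n.
    by rewrite -(subnKC Nn) -addnS !zx.
  have e1 : (n + (N - n.+1).+1 = N)%N by rewrite addnS -addSn subnKC.
  have e2 : (n.+1 + (N - n.+1) = N)%N by rewrite subnKC.
  by rewrite (zy _ _ e1) (zy _ _ e2) metric_sym yS.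
have zSS n : mdist (z n) (z n.+2) = 2 * r.
  have [Nn|nN] := leqP N n.
    by rewrite -(subnKC Nn) -!addnS !zx.
  (* The two steps straddle [c] exactly here; their ends are [q] and [p]. *)
  have [nN1|nN1] := eqVneq n.+1 N.
    have -> : z n.+2 = x 1%N by rewrite -zx -nN1 addn1.
    by rewrite (zy n 1%N) ?addn1// x1 y1 metric_sym.
  have nN2 : (n.+2 <= N)%N by rewrite ltn_neqAle nN1.
  have e1 : (n + (N - n.+2).+2 = N)%N by rewrite !addnS -!addSn subnKC.
  have e2 : (n.+2 + (N - n.+2) = N)%N by rewrite subnKC.
  by rewrite (zy _ _ e1) (zy _ _ e2) metric_sym ySS.
have toR k : - N%:Z <= k -> (absz (k + N%:Z))%:R = k%:~R + N%:R :> R.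
  move=> Nk; have Nk0 : 0 <= k + N%:Z by rewrite -lerBlDr sub0r.
  by rewrite natr_absz ger0_norm// intrD.
exists (fun i => z (absz (i + N%:Z))); split.
  by rewrite add0r -[X in z X]addn0 zx x0.
move=> i j Ni Nj; rewrite (chain_dist r)// !toR//.
by rewrite opprD addrACA subrr addr0.
Qed.

End BanakhGeometry.

(** * Common divisors and density in subgroups of the rationals *)

Section RationalSubgroups.
Context {G : {pred rat}}.
Hypothesis Gzmod : zmod_closed G.
Implicit Types (a b e g h : rat).

Lemma subgroupD a b : a \in G -> b \in G -> a + b \in G.
Proof.
have [G0 GB] := Gzmod; move=> Ga Gb.
by rewrite -[b]opprK -[- b]sub0r; apply: (GB) => //; exact: GB.
Qed.

Lemma subgroupMz a (n : int) : a \in G -> a *~ n \in G.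
Proof.
have [G0 GB] := Gzmod; move=> Ga.
have GM k : a *+ k \in G.
  by elim: k => [|k IH]; rewrite ?mulr0n// mulrS subgroupD.
case: n => n; first exact: GM.
by rewrite NegzE mulrNz -sub0r; apply: GB => //; exact: GM.
Qed.

(** Over the common denominator [N], the Bezout identity shows that the gcd of the numerators,
    divided by [N], lies in [G]. *)
Lemma subgroup_common_divisor a b : a \in G -> b \in G ->
  exists2 e, e \in G & exists m n : int, a = e *~ m /\ b = e *~ n.
Proof.
move=> Ga Gb.
pose A := numq a * denq b; pose B := numq b * denq a.
have [u [v uv]] := Bezoutz A B.
have /dvdzP[m Am] := dvdz_gcdl A B; have /dvdzP[n Bn] := dvdz_gcdr A B.
pose N : rat := (denq a * denq b)%:~R.
have da : (denq a)%:~R != 0 :> rat by rewrite intr_eq0 denq_neq0.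
have db : (denq b)%:~R != 0 :> rat by rewrite intr_eq0 denq_neq0.
have aE : a = A%:~R / N.
  by rewrite -[LHS]divq_num_den /A /N !intrM; field; rewrite da db.
have bE : b = B%:~R / N.
  by rewrite -[LHS]divq_num_den /B /N !intrM; field; rewrite da db.
have eE : a *~ u + b *~ v = (gcdz A B)%:~R / N.
  by rewrite -uv -[a *~ u]mulrzr -[b *~ v]mulrzr aE bE intrD !intrM; ring.
exists (a *~ u + b *~ v); first by apply: subgroupD; exact: subgroupMz.
exists m, n; rewrite eE -[_ *~ m]mulrzr -[_ *~ n]mulrzr aE bE.
rewrite [in A%:~R]Am [in B%:~R]Bn !intrM.
by split; ring.
Qed.

(** Were there no element of [G] strictly between 0 and [g], all remainders modulo [g] would vanish
    and [g] would generate [G]. An element [h] above [g / 2] is replaced by [g - h]. *)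
Lemma subgroup_halving g : ~ cyclic_subgroup G -> g \in G -> 0 < g ->
  exists h, [/\ h \in G, 0 < h & h <= g / 2].
Proof.
have [G0 GB] := Gzmod; move=> ncG Gg g0.
have [h [Gh h0 hg]] : exists h, [/\ h \in G, 0 < h & h < g].
  apply: contrapT => noh; apply: ncG; exists g.
  apply/seteqP; split=> [x /= Gx|_ [n _ <-]/=]; last exact: subgroupMz.
  exists (Num.floor (x / g)) => //; apply: contrapT => /eqP xg.
  have lo := floor_le (x / g); have hi := floorD1_gt (x / g).
  rewrite ler_pdivlMr// in lo; rewrite intrD ltr_pdivrMr// in hi.
  apply: noh; exists (x - g *~ Num.floor (x / g)); split.
  - by apply: GB => //; exact: subgroupMz.
  - by rewrite subr_gt0 lt_neqAle xg -mulrzr mulrC.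
  - by rewrite -mulrzr; lra.
have [hle|hgt] := leP h (g / 2); first by exists h.
by exists (g - h); split; [exact: GB| lra| lra].
Qed.

Lemma subgroup_exists_gt0 : ~ cyclic_subgroup G -> exists2 g, g \in G & 0 < g.
Proof.
have [G0 GB] := Gzmod; move=> ncG; apply: contrapT => nog; apply: ncG.
exists 0; apply/seteqP; split=> [x /= Gx|_ [n _ <-]/=]; last by rewrite mul0rz.
exists 0 => //; rewrite mulr0z; have [x0|x0|//] := ltgtP x 0.
  by exfalso; apply: nog; exists (- x); rewrite ?oppr_gt0// -sub0r GB.
by exfalso; apply: nog; exists x.
Qed.

Lemma subgroup_small_gt0 (R : realType) (eps : R) :
  ~ cyclic_subgroup G -> 0 < eps ->
  exists g, [/\ g \in G, 0 < g & ratr g < eps].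
Proof.
move=> ncG eps0; have [g Gg g0] := subgroup_exists_gt0 ncG.
have halved n : exists h, [/\ h \in G, 0 < h & h * 2 ^+ n <= g].
  elim: n => [|n [h [Gh h0 hg]]]; first by exists g; rewrite mulr1.
  have [k [Gk k0 kh]] := subgroup_halving _ ncG Gh h0; exists k; split=> //.
  rewrite exprS mulrA; apply: le_trans hg; rewrite ler_pM2r ?exprn_gt0//; lra.
(* As [2 ^+ n] exceeds [n], which exceeds [ratr g / eps], this many halvings suffice. *)
pose n := (Num.truncn (ratr g / eps)).+1.
have [h [Gh h0 hg]] := halved n; exists h; split=> //.
have gn : ratr g / eps < n%:R by rewrite truncnS_gt.
have n2 : n%:R < 2 ^+ n :> R by rewrite -natrX ltr_nat ltn_expl.
have := lt_trans gn n2; rewrite ltr_pdivrMr// => geps.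
rewrite -(ler_rat R) rmorphM rmorphXn/= rmorph_nat in hg.
have n20 : 0 < 2 ^+ n :> R by rewrite exprn_gt0.
by rewrite -(ltr_pM2r n20) [eps * _]mulrC (le_lt_trans hg).
Qed.

Lemma subgroup_dense (R : realType) (t eps : R) :
  ~ cyclic_subgroup G -> 0 < eps ->
  exists2 g, g \in G & `|ratr g - t| < eps.
Proof.
move=> ncG /(subgroup_small_gt0 _ _ ncG)[e [Ge e0 eeps]].
have {}e0 : 0 < ratr e :> R by rewrite ltr0q.
have lo := floor_le (t / ratr e); have hi := floorD1_gt (t / ratr e).
rewrite ler_pdivlMr// in lo; rewrite intrD ltr_pdivrMr// in hi.
(* The largest multiple of [e] not above [t] misses it by less than [e]. *)
exists (e *~ Num.floor (t / ratr e)); first exact: subgroupMz.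
rewrite rmorphMz/= -mulrzr mulrC distrC ger0_norm ?subr_ge0//; lra.
Qed.

End RationalSubgroups.

(** * Extending an isometry from a dense subset of the line *)

Section Extension.
Context {R : realType} {X : metricType R}.

Lemma extend_dense_isometry {I : Type} (j : I -> R) (f : I -> X) :
  complete_space X ->
  (forall t eps : R, 0 < eps -> exists i, `|j i - t| < eps) ->
  (forall i k, mdist (f i) (f k) = `|j i - j k|) ->
  exists F : R -> X, forall s t, mdist (F s) (F t) = `|s - t|.
Proof.
move=> complX dense isof.
(* The value at [t] will be a limit of this filter, which is proper by density and Cauchy because
   [f] preserves distances. *)
pose near_t (t : R) := filter_from [set e : R | 0 < e]
  (fun e => [set f i | i in [set i | `|j i - t| < e]]).
have near_proper t : ProperFilter (near_t t).
  apply: filter_from_proper => [|e /= e0]; last first.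
    by have [i ie] := dense t e e0; exists (f i), i.
  apply: filter_from_filter; first by exists 1; rewrite /= ltr01.
  move=> e1 e2 /= e10 e20; exists (Num.min e1 e2); first by rewrite lt_min e10.
  by move=> x [i /=]; rewrite lt_min => /andP[i1 i2] <-; split; exists i.
have near_cauchy t : cauchy (near_t t).
  apply: cauchy_exP => e e0; have e20 : 0 < e / 2 by rewrite divr_gt0.
  have [i ie] := dense t _ e20; exists (f i), (e / 2) => //.
  move=> _ [k /= ke <-]; rewrite ballEmdist /= isof.
  have := ler_normD (j i - t) (t - j k); rewrite addrA subrK (distrC t); lra.
have approx t : exists x, forall e, 0 < e ->
    exists i, `|j i - t| < e /\ mdist x (f i) < e.
  have [x cvx] := complX _ (near_proper t) (near_cauchy t); exists x => e e0.
  have [d /= d0 dx] := cvx _ (nbhsx_ballx x e e0).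
  have [i] := dense t (Num.min d e) ltac:(by rewrite lt_min d0).
  rewrite lt_min => /andP[id ie]; exists i; split=> //.
  by have := dx (f i); rewrite ballEmdist; apply; exists i.
have [F FP] := boolp.choice approx; exists F => s t.
(* Replacing [s], [t], [F s] and [F t] by their approximations costs less than [e / 4] each. *)
apply/eqP; rewrite -subr_eq0 -normr_eq0 eq_le normr_ge0 andbT.
apply/ler_addgt0Pl => e e0; rewrite addr0.
have e40 : 0 < e / 4 by rewrite divr_gt0.
have [i [is_ Fs]] := FP s _ e40; have [k [kt Ft]] := FP t _ e40.
have := metric_triangle (F s) (f i) (F t).
have := metric_triangle (f i) (f k) (F t).
have := metric_triangle (f i) (F s) (f k).
have := metric_triangle (F s) (F t) (f k).
rewrite (metric_sym (f i) (F s)) (metric_sym (f k) (F t)) isof.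
move: is_ kt; rewrite !ltr_norml => /andP[? ?] /andP[? ?].
move=> dis dik dit dst; rewrite ler_norml; move: dis dik dit dst.
case: (ger0P (j i - j k)) => ?; case: (ger0P (s - t)) => ?; lra.
Qed.

End Extension.

Lemma oppz_le_absz (N : nat) (i : int) : (`|i| <= N)%N -> - N%:Z <= i.
Proof. lia. Qed.

(** * From a Banakh space to the line *)

Section BanakhToLine.
Context {R : realType} {X : metricType R} {G : {pred rat}}.
Hypothesis banakhX : banakh_space X.
Hypothesis Gzmod : zmod_closed G.
Hypothesis Gdist : nonneg_part (ratr @` [set` G]) `<=` distances X.

Lemma ratr_distance e : e \in G -> 0 <= e -> distances X (ratr e : R).
Proof. by move=> Ge e0; apply: Gdist; split; [exists e | rewrite /= ler0q]. Qed.

(** The lines used for different pairs [h], [k] are chosen independently. They agree because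
    [coords] places [c] at 0 and [p] at [g], and at most one point has the prescribed distances to
    these two. *)
Lemma subgroup_isometry g : g \in G -> 0 < g ->
  exists f : rat -> X, forall h k, h \in G -> k \in G ->
    mdist (f h) (f k) = `|ratr h - ratr k|.
Proof.
move=> Gg g0; have gR0 : 0 < ratr g :> R by rewrite ltr0q.
have gX := ratr_distance _ Gg (ltW g0).
(* A pair realizing the distance [ratr g] provides a point of [X]. *)
have [[c0 _] _ _] := gX.
have [p pc] := sphere_nonempty banakhX c0 gX; move: c0 pc => c pc.
pose coords h x := mdist x c = `|ratr h| /\ mdist x p = `|ratr h - ratr g|.
have cp : c != p by rewrite -mdist_gt0 metric_sym pc.
have coords_pair h k : h \in G -> k \in G -> exists x y,
    [/\ coords h x, coords k y & mdist x y = `|ratr h - ratr k|].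
  move=> Gh Gk.
  have [e1 Ge1 [h1 [k1 [hE kE]]]] := subgroup_common_divisor Gzmod _ _ Gh Gk.
  have [e Ge [l [m [e1E gE]]]] := subgroup_common_divisor Gzmod _ _ Ge1 Gg.
  wlog e0 : e l m Ge e1E gE / 0 < e.
    move=> W; have [e0|e0|e0] := ltgtP e 0; last 2 first.
    - exact: (W e l m).
    - by move: g0; rewrite gE e0 mul0rz ltxx.
    apply: (W (- e) (- l) (- m)); rewrite ?mulrNz ?mulNrz ?opprK ?oppr_gt0//.
    by rewrite -[- e]mulrN1z; exact: subgroupMz.
  have eR0 : 0 < ratr e :> R by rewrite ltr0q.
  have hR : ratr h = (l * h1)%:~R * ratr e :> R.
    by rewrite hE e1E -mulrzA rmorphMz/= -mulrzl.
  have kR : ratr k = (l * k1)%:~R * ratr e :> R.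
    by rewrite kE e1E -mulrzA rmorphMz/= -mulrzl.
  have gR : ratr g = m%:~R * ratr e :> R by rewrite gE rmorphMz/= -mulrzl.
  move: (l * h1) (l * k1) hR kR => a b hR kR.
  (* Long enough for the line to reach the indices of [h], [k], [g] and their negatives. *)
  pose N := (`|a| + `|b| + `|m|)%N.
  have aN : (`|a| <= N)%N by rewrite /N -addnA leq_addr.
  have bN : (`|b| <= N)%N by rewrite /N addnAC leq_addl.
  have mN : (`|m| <= N)%N by rewrite leq_addl.
  have eX := ratr_distance _ Ge (ltW e0).
  have [u [u0 uD]] := exists_line banakhX _ c N eR0 eX.
  have uDN i j : (`|i| <= N)%N -> (`|j| <= N)%N ->
      mdist (u i) (u j) = `|i%:~R - j%:~R| * ratr e.
    by move=> /oppz_le_absz iN /oppz_le_absz jN; exact: uD.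
  have normM (x : R) : `|x| * ratr e = `|x * ratr e|.
    by rewrite normrM (gtr0_norm eR0).
  (* The sphere about [c] through [p] meets the line at [m] and [- m], so [p] is one of these two
     points; the sign [s] orients the line so that [p] has index [m]. *)
  have [s [s1 ps]] : exists s : int, (s = 1 \/ s = - 1) /\ p = u (s * m).
    have umc i : `|i|%N = `|m|%N -> mdist (u i) c = ratr g.
      move=> im; rewrite -u0 uDN ?im// subr0 -intr_norm -abszE im abszE.
      by rewrite intr_norm normM -gR gtr0_norm.
    have [] := cospherical_eq banakhX c (u m) (u (- m)) p.
    - by rewrite !umc// abszN.
    - by rewrite pc umc.
    - rewrite -mdist_gt0 uDN ?abszN//.
      rewrite mulr_gt0// normr_gt0 mulrNz opprK -mulr2n mulrn_eq0/=.
      rewrite intr_eq0; apply: contraTneq gR0 => m0.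
      by rewrite gR m0 mul0r ltxx.
    - by move=> ->; exists 1; rewrite mul1r; split=> //; left.
    - by move=> ->; exists (- 1); rewrite mulN1r; split=> //; right.
  have sN (i : int) : `|(s * i)%R|%N = `|i|%N.
    by rewrite abszM; case: s1 => ->; rewrite mul1n.
  have norms i : `|(s * i)%:~R| = `|i%:~R| :> R.
    by case: s1 => ->; rewrite ?mul1r// mulN1r mulrNz normrN.
  have uDs i j : (`|i| <= N)%N -> (`|j| <= N)%N ->
      mdist (u (s * i)) (u (s * j)) = `|i%:~R * ratr e - j%:~R * ratr e|.
    move=> iN jN; rewrite uDN ?sN//.
    by rewrite -mulrBl -normM -!intrB -mulrBr norms.
  have us0 i : (`|i| <= N)%N -> mdist (u (s * i)) c = `|i%:~R * ratr e|.
    by move=> iN; have := uDs i 0 iN (leq0n _); rewrite mulr0 u0 mul0r subr0.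
  exists (u (s * a)), (u (s * b)); rewrite /coords ps hR kR gR.
  by rewrite !us0// !uDs.
have coords_uniq h x y : coords h x -> coords h y -> x = y.
  move=> [xc xp] [yc yp].
  by apply: (eq_from_two_distances banakhX _ _ _ _ cp); rewrite ?xc ?xp.
have coords_ex h : exists x, h \in G -> coords h x.
  have [Gh|] := boolP (h \in G); last by exists c.
  by have [x [_ [hx _ _]]] := coords_pair h h Gh Gh; exists x.
have [f fP] := boolp.choice coords_ex; exists f => h k Gh Gk.
have [x [y [hx ky <-]]] := coords_pair h k Gh Gk.
rewrite (coords_uniq h (f h) x (fP h Gh) hx).
by rewrite (coords_uniq k (f k) y (fP k Gk) ky).
Qed.

Lemma line_isometry_surjective (F : R -> X) :
  (forall s t, mdist (F s) (F t) = `|s - t|) -> forall x, exists t, F t = x.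
Proof.
move=> isoF x; have [->|x0] := eqVneq x (F 0); first by exists 0.
have r0 : 0 < mdist x (F 0) by rewrite mdist_gt0.
have [] := cospherical_eq banakhX (F 0)
  (F (mdist x (F 0))) (F (- mdist x (F 0))) x.
- by rewrite !isoF !subr0 normrN.
- by rewrite isoF subr0 gtr0_norm.
- by rewrite -mdist_gt0 isoF normr_gt0; lra.
- by move=> ->; eexists.
- by move=> ->; eexists.
Qed.

End BanakhToLine.

(** * From the line to a Banakh space *)

Section LineToBanakh.
Context {R : realType} {X : metricType R} (f : X -> R^o).
Hypothesis isof : Defs.isometry f.

Lemma line_isometryE x y : mdist x y = `|f x - f y|.
Proof. by rewrite -(proj1 isof) distrC. Qed.

Lemma line_isometry_onto t : exists x, f x = t.
Proof. by have [x _ <-] := proj2 isof t I; exists x. Qed.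

Lemma line_complete : complete_space X.
Proof.
move=> F PF cF.
have cfF : cauchy (f @ F).
  apply/cauchyP => e e0; have [x Fx] := (cauchyP F).1 cF e e0.
  exists (f x); apply: (@filterS _ F _ _ _ _ Fx) => y.
  by rewrite ballEmdist /= line_isometryE.
have /cauchy_cvgP/cvg_ex[/= l fFl] := cfF.
have [x xl] := line_isometry_onto l; exists x.
apply/metricType_numDomainType.fcvgrPdist_lt => e e0.
have fFe := metricType_numDomainType.cvgr_dist_lt fFl e0.
by apply: (@filterS _ F _ _ _ _ (fFe _)) => y; rewrite -xl (proj1 isof).
Qed.

Lemma line_banakh : banakh_space X.
Proof.
move=> c r [[a b] _ /= abr].
have r0 : 0 <= r by rewrite -abr mdist_ge0.
have [x fx] := line_isometry_onto (f c + r).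
have [y fy] := line_isometry_onto (f c - r).
have f_inj u v : f u = f v -> u = v.
  by move=> uv; apply: mdist_positivity; rewrite line_isometryE uv subrr normr0.
exists x, y; split; last by rewrite line_isometryE fx fy ger0_norm; lra.
apply/seteqP; split=> [z|z] /=; rewrite /sphere /= line_isometryE.
  move=> zr; have [zc|zc] := ger0P (f z - f c); [left|right]; apply: f_inj.
    by rewrite fx -zr ger0_norm// addrC subrK.
  by rewrite fy -zr ltr0_norm// opprK addrC subrK.
move=> [->|->].
  by rewrite fx addrAC subrr add0r ger0_norm.
by rewrite fy addrAC subrr add0r normrN ger0_norm.
Qed.

Lemma line_distances r : 0 <= r -> distances X r.
Proof.
move=> r0; have [x fx] := line_isometry_onto r.
have [y fy] := line_isometry_onto 0.
by exists (x, y) => //=; rewrite line_isometryE fx fy subr0 ger0_norm.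
Qed.

End LineToBanakh.

(** A generator [g] is nonzero because 1 is a multiple of it, and [g / 2] would be an integer
    multiple too, making 1 even. *)
Lemma rat_not_cyclic : ~ cyclic_subgroup (xpredT : {pred rat}).
Proof.
move=> [g gT].
have : range (fun n : int => g *~ n) (g / 2) by rewrite -gT.
have : range (fun n : int => g *~ n) 1 by rewrite -gT.
move=> [m _ gm] [n _].
have g0 : g != 0.
  by apply: contraTneq (oner_neq0 rat) => g0; rewrite -gm g0 mul0rz eqxx.
rewrite -mulrzr => /(mulfI g0) n2.
have : (n * 2)%:~R = 1%:~R :> rat by rewrite intrM n2 mulVf.
by move/intr_inj; lia.
Qed.

(* The regular algebra R^o carries the metric structure mdist x y = `|y - x|. *)
Theorem theorem7p2 (R : realType) (X : metricType R) :
  isometric X R^o <->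
  [/\ complete_space X,
      banakh_space X
    & exists G : {pred rat},
        [/\ zmod_closed G,
            ~ cyclic_subgroup G
          & nonneg_part (ratr @` [set` G]) `<=` distances X]].
Proof.
split=> [[f isof]|[complX banakhX [G [Gzmod ncG GX]]]].
  split; [exact: line_complete isof|exact: line_banakh isof|].
  exists xpredT; split=> //; first exact: rat_not_cyclic.
  by move=> r [_ r0]; exact: line_distances isof _ r0.
have [g Gg g0] := subgroup_exists_gt0 Gzmod ncG.
have [f isof] := subgroup_isometry banakhX Gzmod GX _ Gg g0.
have [F isoF] : exists F : R -> X, forall s t, mdist (F s) (F t) = `|s - t|.
  (* Only elements of [G] serve as indices, since [f] is controlled only there. *)
  pose j (h : {h | h \in G}) : R := ratr (sval h).
  apply: (extend_dense_isometry j (fun h => f (sval h))) => //.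
    move=> t e e0; have [h Gh ht] := subgroup_dense Gzmod _ t _ ncG e0.
    by exists (exist _ h Gh).
  by move=> [h Gh] [k Gk]; exact: isof.
(* The isometry must go from [X] to the line, so [F] is inverted. *)
have [F' F'K] := boolp.choice (line_isometry_surjective banakhX _ isoF).
exists F'; split=> [x y|t _].
  by rewrite [LHS]/mdist/= distrC -isoF !F'K.
exists (F t) => //; apply/eqP; rewrite -subr_eq0 -normr_eq0 -isoF F'K.
by rewrite mdistxx.
Qed.
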